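(* Let $l>0$, $L>0$, $y_l\in\mathbb{R}$, let $\alpha,\beta\colon\mathbb{R}^2\to\mathbb{R}$ have continuous first-order partial derivatives and let $\varphi\colon\mathbb{R}^2\to\mathbb{R}$ have continuous partial derivatives up to the second order, with $\varphi(0,0)=0$. Consider the problem of minimizing the functional $$J(y)=\int_{0}^{l}\alpha(x,y(x))\sqrt{1+y'(x)^2+z'(x)^2}\int_{0}^{x} \sqrt{1+y'(\xi)^2+z'(\xi)^2}\,d\xi\, dx+\int_{0}^{l}\beta(x,y(x))\sqrt{1+y'(x)^2+z'(x)^2}\,dx,$$ where $z(x)=\varphi(x,y(x))$, subject to the boundary conditions $y(0)=0$, $y(l)=y_l$. There exists a solution of this problem on the set $$Y=\left\{f\in \mathbb{C}^1_L[0,l]\colon f(0)=0,\ f(l)=y_l,\ |f'(0)|\leq L\right\},$$ i.e. $J$ attains its minimum on $Y$.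
   Context: $\mathbb{C}^1_L[0,l]$ denotes the set of continuously differentiable functions $f\colon[0,l]\to\mathbb{R}$ whose derivative $f'$ satisfies the Lipschitz condition with constant $L$ on $[0,l]$. In $J(y)$, $z'(x)=\varphi_x(x,y(x))+\varphi_y(x,y(x))\,y'(x)$, where $\varphi_x,\varphi_y$ are the partial derivatives of $\varphi$.
   Formalization: The set Y is additionally assumed to be nonempty; for |y_l| > L l + L l²/2 (e.g. l = L = 1, y_l = 10) Y is empty, so no minimum can be attained. *)

(* Defs.v *)
From Stdlib Require Import Reals.
From Coquelicot Require Import Coquelicot.
Open Scope R_scope.

(* A function on [0,l] is represented by a total function R -> R whose values
   outside [0,l] are irrelevant: every notion below only looks at its
   restriction to [0,l].  In particular derivatives at 0 and l are one-sided,
   so Coquelicot's two-sided [ex_derive] and [Derive] are not used for them. *)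

Definition segm (l x : R) : Prop := 0 <= x <= l.

Definition ex_derive_segm (l : R) (f : R -> R) (x : R) : Prop :=
  exists d : R, D_in f (fun _ => d) (segm l) x.

(* [iota P] is the unique element satisfying P, when there is exactly one. *)
Definition Derive_segm (l : R) (f : R -> R) (x : R) : R :=
  iota (fun d : R => D_in f (fun _ => d) (segm l) x).

Definition C1_segm (l : R) (f : R -> R) : Prop :=
  (forall x, segm l x -> ex_derive_segm l f x) /\
  continuous_on (segm l) (Derive_segm l f).

Definition C1L (L l : R) (f : R -> R) : Prop :=
  C1_segm l f /\
  forall x1 x2, segm l x1 -> segm l x2 ->
    Rabs (Derive_segm l f x1 - Derive_segm l f x2) <= L * Rabs (x1 - x2).

(* [ex_diff_n f n x y] requires all partial derivatives of f of order 0..n,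
   mixed ones in either order included, to be continuous at (x, y). *)
Definition Cn_plane (n : nat) (f : R -> R -> R) : Prop :=
  forall x y, ex_diff_n f n x y.

Definition zprime (phi : R -> R -> R) (l : R) (y : R -> R) (x : R) : R :=
  Derive (fun u => phi u (y x)) x
  + Derive (fun v => phi x v) (y x) * Derive_segm l y x.

Definition arc_density (phi : R -> R -> R) (l : R) (y : R -> R) (x : R) : R :=
  sqrt (1 + Derive_segm l y x ^ 2 + zprime phi l y x ^ 2).

Definition J (alpha beta phi : R -> R -> R) (l : R) (y : R -> R) : R :=
  RInt (fun x => alpha x (y x) * arc_density phi l y x
                 * RInt (fun xi => arc_density phi l y xi) 0 x) 0 l
  + RInt (fun x => beta x (y x) * arc_density phi l y x) 0 l.

Definition Y (L l yl : R) (f : R -> R) : Prop :=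
  C1L L l f /\ f 0 = 0 /\ f l = yl /\ Rabs (Derive_segm l f 0) <= L.

(* Main.v *)
Require Import Defs.
From Stdlib Require Import Reals Lra Lia ClassicalEpsilon.
From Coquelicot Require Import Coquelicot.
Open Scope R_scope.

(** An element of [Y] is determined by its derivative [g], and [J] is a
    functional of [g] which is continuous along pointwise convergent sequences of
    [L]-Lipschitz functions.  Call a set of derivatives dominating if it contains,
    for every competitor, an element with a value of the functional at most as
    large.  When a dominating set is a union of two sets, one of them is
    dominating; bisecting the values on a finite grid, each dominating set
    therefore contains a dominating set of arbitrarily small uniform diameter.  A
    decreasing sequence of such sets shrinks to a single [g], which is the limit
    of better elements than any given competitor, hence a minimizer.  No
    subsequence has to be extracted, and no infimum has to be shown finite. *)

(** * Continuous convergence of sequences of functions *)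

(* Continuous convergence: unlike uniform convergence on compact sets, to which it
   is equivalent here, it passes trivially through compositions. *)
Definition cconv (F : nat -> R -> R) (f : R -> R) : Prop :=
  (forall k x, continuous (F k) x) /\
  forall x, filterlim (fun p => F (fst p) (snd p))
              (filter_prod eventually (locally x)) (locally (f x)).

Lemma cconv_const (f : R -> R) :
  (forall x, continuous f x) -> cconv (fun _ => f) f.
Proof.
  intros Hf; split; [easy|]. intros x.
  apply (filterlim_comp _ _ _ snd f _ (locally x)); [apply filterlim_snd | apply Hf].
Qed.

Lemma cconv_comp2 (M : R -> R -> R) (F G : nat -> R -> R) (f g : R -> R) :
  (forall x y, continuity_2d_pt M x y) -> cconv F f -> cconv G g ->
  cconv (fun k x => M (F k x) (G k x)) (fun x => M (f x) (g x)).
Proof.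
  intros HM [HF HFf] [HG HGg].
  (* A ball around a pair is a product of balls, so continuity in two variables becomes convergence
     along the product filter that composition expects. *)
  assert (HM' : forall x y, filterlim (fun z : R * R => M (fst z) (snd z))
            (filter_prod (locally x) (locally y)) (locally (M x y))).
  { intros x y. pose proof (proj1 (continuity_2d_pt_filterlim M x y) (HM x y)) as H.
    eapply filterlim_filter_le_1; [|exact H].
    intros P [d Hd]. apply Filter_prod with (ball x d) (ball y d);
      [apply locally_ball | apply locally_ball|].
    intros u v Hu Hv. apply Hd. split; assumption. }
  split.
  - intros k x. unfold continuous. eapply filterlim_comp_2; [apply HF | apply HG | apply HM'].
  - intros x. eapply (filterlim_comp_2 (fun p => F (fst p) (snd p)) (fun p => G (fst p) (snd p)));
      [apply HFf | apply HGg | apply HM'].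
Qed.

Lemma cconv_comp (h : R -> R) (F : nat -> R -> R) (f : R -> R) :
  (forall x, continuous h x) -> cconv F f ->
  cconv (fun k x => h (F k x)) (fun x => h (f x)).
Proof.
  intros Hh [HF HFf]; split.
  - intros k x. apply (filterlim_comp _ _ _ (F k) h _ (locally (F k x))); [apply HF | apply Hh].
  - intros x. eapply (filterlim_comp _ _ _ (fun p => F (fst p) (snd p)) h); [apply HFf | apply Hh].
Qed.

Lemma cconv_plus (F G : nat -> R -> R) (f g : R -> R) :
  cconv F f -> cconv G g -> cconv (fun k x => F k x + G k x) (fun x => f x + g x).
Proof.
  apply (cconv_comp2 Rplus). intros x y.
  apply (continuity_2d_pt_plus (fun x _ => x) (fun _ y => y));
    [apply continuity_2d_pt_id1 | apply continuity_2d_pt_id2].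
Qed.

Lemma cconv_mult (F G : nat -> R -> R) (f g : R -> R) :
  cconv F f -> cconv G g -> cconv (fun k x => F k x * G k x) (fun x => f x * g x).
Proof.
  apply (cconv_comp2 Rmult). intros x y.
  apply (continuity_2d_pt_mult (fun x _ => x) (fun _ y => y));
    [apply continuity_2d_pt_id1 | apply continuity_2d_pt_id2].
Qed.

Lemma cconv_eps (F : nat -> R -> R) (f : R -> R) (x eps : R) :
  cconv F f -> 0 < eps ->
  exists N (d : posreal), forall k y, (N <= k)%nat -> Rabs (y - x) < d ->
    Rabs (F k y - f x) < eps.
Proof.
  intros [_ H] He. specialize (H x).
  destruct (H (ball (f x) (mkposreal _ He)) (locally_ball _ _)) as [Q R' [N HN] [d Hd] HQR].
  exists N, d. intros k y Hk Hy. apply (HQR k y); [apply HN, Hk | apply Hd, Hy].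
Qed.

Lemma cconv_pointwise (F : nat -> R -> R) (f : R -> R) (x : R) :
  cconv F f -> is_lim_seq (fun k => F k x) (f x).
Proof.
  intros H. apply is_lim_seq_spec. intros eps.
  destruct (cconv_eps F f x eps H (cond_pos eps)) as (N & d & HN).
  exists N. intros k Hk. apply HN; [easy|].
  rewrite Rminus_diag, Rabs_R0. apply cond_pos.
Qed.

(** Near [x], all [F k y] with [k] large are close to [f x]; letting [k] grow with [y] fixed carries
    this closeness over to [f y]. *)
Lemma cconv_limit_continuous (F : nat -> R -> R) (f : R -> R) (x : R) :
  cconv F f -> continuous f x.
Proof.
  intros H. apply filterlim_locally. intros eps.
  assert (He : 0 < eps / 2) by (destruct eps; simpl; lra).
  destruct (cconv_eps F f x _ H He) as (N & d & HN).
  exists d. intros y Hy.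
  pose proof (cconv_pointwise F f y H) as Hl. apply is_lim_seq_spec in Hl.
  destruct (Hl (mkposreal _ He)) as [N' HN']. simpl in HN'.
  specialize (HN (max N N') y ltac:(lia) Hy). specialize (HN' (max N N') ltac:(lia)).
  change (Rabs (f y - f x) < eps).
  apply Rabs_def2 in HN, HN'. apply Rabs_def1; lra.
Qed.

Lemma cconv_uniform (F : nat -> R -> R) (f : R -> R) (a b eps : R) :
  cconv F f -> 0 < eps ->
  exists N, forall k x, (N <= k)%nat -> a <= x <= b -> Rabs (F k x - f x) < eps.
Proof.
  intros H He.
  (* The rank N(t) beyond which F k is close to f around t is encoded in the radius:
     delta t <= 1 / (N(t) + 1), so a lower bound on delta bounds N. *)
  assert (Hd : forall t, exists d : posreal, forall k y, / d - 1 <= INR k ->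
     Rabs (y - t) < d -> Rabs (F k y - f y) < eps).
  { intros t. assert (He' : 0 < eps / 2) by lra.
    destruct (cconv_eps F f t _ H He') as (N & d1 & H1).
    pose proof (cconv_limit_continuous F f t H) as Hc.
    pose proof (proj1 (filterlim_locally f (f t)) Hc (mkposreal _ He')) as [d2 H2].
    assert (HN : 0 < / (INR N + 1)).
    { apply Rinv_0_lt_compat. pose proof (pos_INR N). lra. }
    assert (Hd : 0 < Rmin (/ (INR N + 1)) (Rmin d1 d2)).
    { apply Rmin_pos; [easy | apply Rmin_pos; apply cond_pos]. }
    exists (mkposreal _ Hd). simpl. intros k y Hk Hy.
    pose proof (Rmin_l (/ (INR N + 1)) (Rmin d1 d2)).
    pose proof (Rmin_r (/ (INR N + 1)) (Rmin d1 d2)).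
    pose proof (Rmin_l d1 d2). pose proof (Rmin_r d1 d2).
    assert (Hk' : (N <= k)%nat).
    { apply INR_le. apply Rinv_le_contravar in H0; [|easy].
      rewrite Rinv_inv in H0. lra. }
    specialize (H1 k y Hk' ltac:(lra)).
    assert (H2' : Rabs (f y - f t) < eps / 2) by (apply (H2 y); change (Rabs (y - t) < d2); lra).
    apply Rabs_def2 in H1, H2'. apply Rabs_def1; lra. }
  pose (delta := fun t => proj1_sig (constructive_indefinite_description _ (Hd t))).
  assert (Hdelta : forall t k y, / delta t - 1 <= INR k ->
     Rabs (y - t) < delta t -> Rabs (F k y - f y) < eps).
  { intros t. unfold delta. destruct constructive_indefinite_description. easy. }
  (* Compactness: up to a double negation, each point of [[a, b]] lies within [delta t] of some [t]
     with [d <= delta t]. *)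
  destruct (compactness_value_1d a b delta) as [d Hcov].
  assert (Hdi : 0 < / d) by (apply Rinv_0_lt_compat, cond_pos).
  (* Since [/ d < N + 1], any [k >= N] satisfies [/ delta t - 1 <= / d - 1 < k]; the [- 1] in [Hd]
     leaves room for this floor. *)
  destruct (nfloor_ex (/ d) ltac:(lra)) as [N HN].
  exists N. intros k x Hk Hx. apply le_INR in Hk.
  specialize (Hcov x Hx). apply NNPP in Hcov. destruct Hcov as (t & _ & Ht & Hdt).
  apply (Hdelta t); [|easy].
  apply Rinv_le_contravar in Hdt; [lra | apply cond_pos].
Qed.

(** * Integrals with a variable upper limit, and equi-Lipschitz sequences *)

Lemma ex_RInt_continuous_R (f : R -> R) (a b : R) :
  (forall x, continuous f x) -> ex_RInt f a b.
Proof. intros H. apply (ex_RInt_continuous (V := R_CompleteNormedModule)). intros; apply H. Qed.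

Lemma is_derive_RInt_continuous (f : R -> R) (x : R) :
  (forall x, continuous f x) -> is_derive (RInt f 0) x (f x).
Proof.
  intros H. apply (is_derive_RInt (V := R_NormedModule) f (RInt f 0) 0 x); [|apply H].
  apply filter_forall. intros y. apply (RInt_correct (V := R_CompleteNormedModule)).
  now apply ex_RInt_continuous_R.
Qed.

Lemma continuous_RInt_0_R (f : R -> R) (x : R) :
  (forall x, continuous f x) -> continuous (RInt f 0) x.
Proof.
  intros H. apply (ex_derive_continuous (V := R_NormedModule)).
  exists (f x). now apply is_derive_RInt_continuous.
Qed.

(** Moving the endpoint from [x] to [y] costs little by continuity of [RInt f 0]; replacing [f] by
    [F k] costs at most [Rabs y] times the uniform error on a compact interval. *)
Lemma cconv_RInt (F : nat -> R -> R) (f : R -> R) :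
  cconv F f -> cconv (fun k => RInt (F k) 0) (RInt f 0).
Proof.
  intros H.
  assert (Hf : forall x, continuous f x) by (intros x; now apply (cconv_limit_continuous F)).
  split. { intros k x. apply continuous_RInt_0_R, H. }
  intros x. apply filterlim_locally. intros eps.
  assert (He : 0 < eps / 2) by (destruct eps; simpl; lra).
  pose proof (Rabs_pos x) as Hx0.
  assert (He' : 0 < eps / 2 / (Rabs x + 1)) by (apply Rdiv_lt_0_compat; lra).
  destruct (cconv_uniform F f (- (Rabs x + 1)) (Rabs x + 1) _ H He') as [N HN].
  destruct (proj1 (filterlim_locally _ _) (continuous_RInt_0_R f x Hf) (mkposreal _ He)) as [d Hd].
  (* The cap at 1 keeps [y] in the interval on which [HN] holds. *)
  assert (Hd1 : 0 < Rmin d 1) by (apply Rmin_pos; [apply cond_pos | lra]).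
  apply Filter_prod with (fun k => (N <= k)%nat) (ball x (mkposreal _ Hd1)).
  { now exists N. }
  { apply locally_ball. }
  intros k y Hk Hy. change (Rabs (y - x) < Rmin d 1) in Hy.
  pose proof (Rmin_l d 1) as Hml. pose proof (Rmin_r d 1) as Hmr.
  assert (Hyx : Rabs (RInt f 0 y - RInt f 0 x) < eps / 2).
  { apply (Hd y). change (Rabs (y - x) < d). lra. }
  assert (Hy1 : Rabs y <= Rabs x + 1).
  { replace y with ((y - x) + x) by ring.
    eapply Rle_trans; [apply Rabs_triang|]. lra. }
  assert (HFy : Rabs (RInt (F k) 0 y - RInt f 0 y) <= Rabs (y - 0) * (eps / 2 / (Rabs x + 1))).
  { apply (norm_RInt_le_const_abs (V := R_NormedModule) (fun t => minus (F k t) (f t)) 0 y).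
    - intros t Ht. apply Rlt_le, HN; [easy|].
      unfold Rabs, Rmin, Rmax in *.
      repeat match goal with |- context [Rcase_abs ?u] => destruct (Rcase_abs u)
        | H : context [Rcase_abs ?u] |- _ => destruct (Rcase_abs u)
        | H : context [Rle_dec ?u ?v] |- _ => destruct (Rle_dec u v) end; lra.
    - apply (is_RInt_minus (V := R_NormedModule)); apply (RInt_correct (V := R_CompleteNormedModule));
        apply ex_RInt_continuous_R; [apply H | apply Hf]. }
  assert (Hle : Rabs (y - 0) * (eps / 2 / (Rabs x + 1)) <= eps / 2).
  { rewrite Rminus_0_r.
    apply Rle_trans with ((Rabs x + 1) * (eps / 2 / (Rabs x + 1))).
    - apply Rmult_le_compat_r; lra.
    - right. field. lra. }
  change (Rabs (RInt (F k) 0 y - RInt f 0 x) < eps).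
  replace (RInt (F k) 0 y - RInt f 0 x)
    with ((RInt (F k) 0 y - RInt f 0 y) + (RInt f 0 y - RInt f 0 x)) by ring.
  eapply Rle_lt_trans; [apply Rabs_triang|]. lra.
Qed.

(** A common Lipschitz constant gives equicontinuity, which upgrades pointwise convergence to
    continuous convergence. *)
Lemma cconv_of_lipschitz (L : R) (F : nat -> R -> R) (f : R -> R) :
  (forall k x y, Rabs (F k x - F k y) <= L * Rabs (x - y)) ->
  (forall x, is_lim_seq (fun k => F k x) (f x)) -> cconv F f.
Proof.
  intros HL Hl.
  (* [Rabs L + 1] is a positive Lipschitz constant whatever the sign of [L], so it can be divided
     by. *)
  assert (HL' : forall eps : posreal, 0 < eps / 2 / (Rabs L + 1)).
  { intros eps. pose proof (Rabs_pos L). pose proof (cond_pos eps).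
    apply Rdiv_lt_0_compat; lra. }
  assert (Hd : forall (eps : posreal) k x y,
    Rabs (y - x) < mkposreal _ (HL' eps) -> Rabs (F k y - F k x) < eps / 2).
  { intros eps k x y Hy. simpl in Hy. eapply Rle_lt_trans; [apply HL|].
    apply Rle_lt_trans with ((Rabs L + 1) * Rabs (y - x)).
    - apply Rmult_le_compat_r; [apply Rabs_pos|]. pose proof (Rle_abs L). lra.
    - pose proof (Rabs_pos L).
      apply Rlt_le_trans with ((Rabs L + 1) * (eps / 2 / (Rabs L + 1))).
      + apply Rmult_lt_compat_l; lra.
      + right. field. lra. }
  split.
  - intros k x. apply filterlim_locally. intros eps. exists (mkposreal _ (HL' eps)).
    intros y Hy. change (Rabs (F k y - F k x) < eps).
    specialize (Hd eps k x y Hy). pose proof (cond_pos eps). lra.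
  - intros x. apply filterlim_locally. intros eps.
    assert (He : 0 < eps / 2) by (destruct eps; simpl; lra).
    pose proof (Hl x) as Hlx. apply is_lim_seq_spec in Hlx.
    destruct (Hlx (mkposreal _ He)) as [N HN]. simpl in HN.
    apply Filter_prod with (fun k => (N <= k)%nat) (ball x (mkposreal _ (HL' eps))).
    { now exists N. }
    { apply locally_ball. }
    intros k y Hk Hy. specialize (HN k Hk). specialize (Hd eps k x y Hy).
    change (Rabs (F k y - f x) < eps).
    apply Rabs_def2 in HN, Hd. apply Rabs_def1; lra.
Qed.

(** * The functional expressed through the derivative *)

(** The arc length density of the curve [(x, y x, z x)], with [u] standing for [y x] and [p] for
    [y' x]. *)
Definition arc_integrand (phi : R -> R -> R) (x u p : R) : R :=
  sqrt (1 + p ^ 2 + (Derive (fun s => phi s u) x + Derive (fun t => phi x t) u * p) ^ 2).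

(* [J] as a functional of [g = y'], with [y] recovered as the integral of [g]. *)
Definition JD (alpha beta phi : R -> R -> R) (l : R) (g : R -> R) : R :=
  let H x := arc_integrand phi x (RInt g 0 x) (g x) in
  RInt (fun x => alpha x (RInt g 0 x) * H x * RInt H 0 x) 0 l
  + RInt (fun x => beta x (RInt g 0 x) * H x) 0 l.

Lemma J_eq_JD (alpha beta phi : R -> R -> R) (l : R) (y g : R -> R) :
  0 < l ->
  (forall x, segm l x -> y x = RInt g 0 x) ->
  (forall x, segm l x -> Derive_segm l y x = g x) ->
  J alpha beta phi l y = JD alpha beta phi l g.
Proof.
  intros hl Hy Hg.
  assert (HA : forall x, segm l x ->
    arc_density phi l y x = arc_integrand phi x (RInt g 0 x) (g x)).
  { intros x Hx. unfold arc_density, zprime, arc_integrand.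
    now rewrite (Hg x Hx), (Hy x Hx). }
  unfold J, JD. f_equal; apply RInt_ext; intros x;
    rewrite Rmin_left, Rmax_right by lra; intros Hx.
  - assert (Hx' : segm l x) by (unfold segm; lra).
    rewrite (HA x Hx'), (Hy x Hx'). f_equal.
    apply RInt_ext. intros t. rewrite Rmin_left, Rmax_right by lra. intros Ht.
    apply HA. unfold segm. lra.
  - assert (Hx' : segm l x) by (unfold segm; lra).
    now rewrite (HA x Hx'), (Hy x Hx').
Qed.

(** Both integrands are built from [g] by integration from 0, continuous functions of two variables,
    sums, products and a square root, all of which preserve continuous convergence. *)
Lemma JD_lim (alpha beta phi : R -> R -> R) (l : R) (G : nat -> R -> R) (g : R -> R) :
  Cn_plane 1 alpha -> Cn_plane 1 beta -> Cn_plane 2 phi -> cconv G g ->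
  is_lim_seq (fun k => JD alpha beta phi l (G k)) (JD alpha beta phi l g).
Proof.
  intros Ha Hb Hp HG.
  pose proof (cconv_RInt _ _ HG) as HU.
  assert (Hid : cconv (fun _ x => x) (fun x => x)).
  { apply cconv_const. intros x. apply continuous_id. }
  assert (H1 : cconv (fun _ _ => 1) (fun _ => 1)).
  { apply cconv_const. intros x. apply continuous_const. }
  assert (HH : cconv (fun k x => arc_integrand phi x (RInt (G k) 0 x) (G k x))
                     (fun x => arc_integrand phi x (RInt g 0 x) (g x))).
  { unfold arc_integrand. apply (cconv_comp sqrt); [apply continuous_sqrt|].
    apply cconv_plus.
    - apply cconv_plus; [easy|]. simpl.
      now repeat (apply cconv_mult; [assumption|]).
    - set (Fx := fun u v => Derive (fun s => phi s v) u).
      set (Fy := fun u v => Derive (fun t => phi u t) v).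
      assert (HS : cconv
         (fun k x => Fx x (RInt (G k) 0 x) + Fy x (RInt (G k) 0 x) * G k x)
         (fun x => Fx x (RInt g 0 x) + Fy x (RInt g 0 x) * g x)).
      { apply cconv_plus; [|apply cconv_mult; [|assumption]].
        - apply (cconv_comp2 Fx (fun _ x => x) _ (fun x => x)); [|assumption|assumption].
          intros x y. apply (Hp x y).
        - apply (cconv_comp2 Fy (fun _ x => x) _ (fun x => x)); [|assumption|assumption].
          intros x y. apply (Hp x y). }
      simpl. apply cconv_mult; [exact HS|]. now apply cconv_mult. }
  assert (HA : forall M, Cn_plane 1 M ->
    cconv (fun k x => M x (RInt (G k) 0 x)) (fun x => M x (RInt g 0 x))).
  { intros M HM. apply (cconv_comp2 M (fun _ x => x) _ (fun x => x)); [|assumption|assumption].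
    intros x y. apply (HM x y). }
  (* Each outer integral is the value at [l] of an integral with variable upper limit. *)
  unfold JD. apply is_lim_seq_plus'; refine (cconv_pointwise _ _ l (cconv_RInt _ _ _)).
  - apply cconv_mult; [|exact (cconv_RInt _ _ HH)]. apply cconv_mult; auto.
  - apply cconv_mult; auto.
Qed.

(** * Derivatives on the segment, and the passage between [Y] and [YD] *)

(** The nearest-point retraction onto [[0, l]]; composing with it extends a function to [R] by its
    end values and keeps Lipschitz constants. *)
Definition clamp (l x : R) : R := Rmax 0 (Rmin l x).

Ltac clamp_cases :=
  unfold clamp, segm, Rmax, Rmin in *;
  repeat match goal with |- context [Rle_dec ?u ?v] => destruct (Rle_dec u v)
    | H : context [Rle_dec ?u ?v] |- _ => destruct (Rle_dec u v) end.

Lemma clamp_segm (l x : R) : 0 < l -> segm l (clamp l x).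
Proof. intros hl. clamp_cases; lra. Qed.

Lemma clamp_id (l x : R) : segm l x -> clamp l x = x.
Proof. intros hl. clamp_cases; lra. Qed.

Lemma clamp_lipschitz (l x y : R) : 0 < l -> Rabs (clamp l x - clamp l y) <= Rabs (x - y).
Proof.
  intros hl. clamp_cases; unfold Rabs;
  repeat match goal with |- context [Rcase_abs ?u] => destruct (Rcase_abs u) end; lra.
Qed.

(* The derivatives of the elements of [Y], extended to R by constants. *)
Definition YD (L l yl : R) (g : R -> R) : Prop :=
  (forall x y, Rabs (g x - g y) <= L * Rabs (x - y)) /\
  (forall x, g x = g (clamp l x)) /\ Rabs (g 0) <= L /\ RInt g 0 l = yl.

(** Every point of the segment is an accumulation point of it: from either half one can step inwards
    by [Rmin e l / 2] without leaving. *)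
Lemma D_in_segm_unique (l : R) (f : R -> R) (x d1 d2 : R) :
  0 < l -> segm l x ->
  D_in f (fun _ => d1) (segm l) x -> D_in f (fun _ => d2) (segm l) x -> d1 = d2.
Proof.
  intros hl Hx H1 H2.
  refine (single_limit _ (D_x (segm l) x) d1 d2 x _ H1 H2).
  intros e He. unfold D_x, segm in *.
  assert (Hm : 0 < Rmin e l) by now apply Rmin_pos.
  pose proof (Rmin_l e l). pose proof (Rmin_r e l).
  destruct (Rle_dec x (l / 2)).
  - exists (x + Rmin e l / 2). repeat split; try lra.
    simpl. unfold Rdist. rewrite Rabs_right; lra.
  - exists (x - Rmin e l / 2). repeat split; try lra.
    simpl. unfold Rdist. rewrite Rabs_left; lra.
Qed.

Lemma Derive_segm_unique (l : R) (f : R -> R) (x d : R) :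
  0 < l -> segm l x -> D_in f (fun _ => d) (segm l) x -> Derive_segm l f x = d.
Proof.
  intros hl Hx H. apply (iota_unique (V := R_CompleteNormedModule)); [|exact H].
  intros d' H'. now apply (D_in_segm_unique l f x).
Qed.

Lemma Derive_segm_correct (l : R) (f : R -> R) (x : R) :
  0 < l -> segm l x -> ex_derive_segm l f x ->
  D_in f (fun _ => Derive_segm l f x) (segm l) x.
Proof.
  intros hl Hx [d Hd]. now rewrite (Derive_segm_unique l f x d hl Hx Hd).
Qed.

Lemma D_in_of_is_derive (D : R -> Prop) (f : R -> R) (x d : R) :
  is_derive f x d -> D_in f (fun _ => d) D x.
Proof.
  intros H%is_derive_Reals e He. destruct (H e He) as [a Ha].
  exists a. split; [apply cond_pos|]. intros u [[_ Hu] Hd].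
  simpl in *. unfold Rdist in *.
  specialize (Ha (u - x)). replace (x + (u - x)) with u in Ha by ring.
  apply Ha; [lra | easy].
Qed.

Lemma is_derive_of_D_in (l : R) (f : R -> R) (x d : R) :
  0 < x < l -> D_in f (fun _ => d) (segm l) x -> is_derive f x d.
Proof.
  intros Hx H. apply is_derive_Reals. intros e He. destruct (H e He) as (a & Ha & Hd).
  (* The radius keeps [x + h] inside the segment, so the relative difference quotient is the
     ordinary one. *)
  assert (Hm : 0 < Rmin a (Rmin x (l - x))) by (repeat apply Rmin_pos; lra).
  exists (mkposreal _ Hm). simpl. intros h Hh0 Hh.
  pose proof (Rmin_l a (Rmin x (l - x))). pose proof (Rmin_r a (Rmin x (l - x))).
  pose proof (Rmin_l x (l - x)). pose proof (Rmin_r x (l - x)).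
  specialize (Hd (x + h)). simpl in Hd. unfold Rdist, D_x, segm in Hd.
  replace (x + h - x) with h in Hd by ring.
  apply Hd. apply Rabs_def2 in Hh as Hh'. repeat split; lra.
Qed.

(** Clamping turns continuity relative to the segment into two-sided continuity, also at the
    endpoints, where the mean value theorem asks for it. *)
Lemma continuity_clamp (l : R) (f : R -> R) (x d : R) :
  0 < l -> segm l x -> D_in f (fun _ => d) (segm l) x ->
  continuity_pt (fun u => f (clamp l u)) x.
Proof.
  intros hl Hx H%cont_deriv e He. destruct (H e He) as (a & Ha & Hd).
  exists a. split; [easy|]. intros u [_ Hu].
  rewrite (clamp_id l x Hx). simpl in *. unfold Rdist in *.
  (* [D_x] excludes the point [x] itself, which the clamp may hit. *)
  destruct (Req_dec (clamp l u) x) as [->|Hne].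
  - rewrite Rminus_diag, Rabs_R0. lra.
  - apply Hd. repeat split; try (now apply clamp_segm); try congruence.
    pose proof (clamp_lipschitz l u x hl) as Hl. rewrite (clamp_id l x Hx) in Hl. lra.
Qed.

Lemma lipschitz_continuous (L : R) (g : R -> R) (x : R) :
  (forall x y, Rabs (g x - g y) <= L * Rabs (x - y)) -> continuous g x.
Proof.
  intros H. apply (cconv_of_lipschitz L (fun _ => g) g); [easy | intros; apply is_lim_seq_const | exact 0%nat].
Qed.

(** The mean value theorem applied to [f] clamped minus the integral of [g], whose derivative
    vanishes inside the interval. *)
Lemma FTC_segm (l : R) (f g : R -> R) (x : R) :
  0 < l -> (forall x, continuous g x) ->
  (forall x, segm l x -> D_in f (fun _ => g x) (segm l) x) ->
  segm l x -> f x - f 0 = RInt g 0 x.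
Proof.
  intros hl Hg Hf Hx. unfold segm in Hx.
  destruct (MVT_gen (fun u => f (clamp l u) - RInt g 0 u) 0 x (fun v => g v - g v)) as (c & _ & Hc).
  - rewrite Rmin_left, Rmax_right by lra. intros u Hu.
    apply (is_derive_minus (V := R_NormedModule) (fun v => f (clamp l v)) (RInt g 0)); [|now apply is_derive_RInt_continuous].
    apply is_derive_ext_loc with f.
    + apply locally_interval with 0 l; [simpl; lra | simpl; lra |].
      intros v Hv1 Hv2. simpl in *. rewrite clamp_id; [easy | unfold segm; lra].
    + apply (is_derive_of_D_in l); [lra|]. apply Hf. unfold segm; lra.
  - rewrite Rmin_left, Rmax_right by lra. intros u Hu.
    apply continuity_pt_minus.
    + apply (continuity_clamp l f u (g u)); [easy | | apply Hf]; unfold segm; lra.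
    + apply continuity_pt_filterlim, continuous_RInt_0_R, Hg.
  - rewrite !clamp_id in Hc by (unfold segm; lra).
    rewrite RInt_point in Hc. change (zero : R) with 0 in Hc. lra.
Qed.

Lemma YD_of_Y (L l yl : R) (f : R -> R) :
  0 < l -> 0 < L -> Y L l yl f ->
  exists g, YD L l yl g /\ (forall x, segm l x -> f x = RInt g 0 x) /\
    forall x, segm l x -> Derive_segm l f x = g x.
Proof.
  intros hl hL [[[Hd Hc] HL] (H0 & Hfl & HD0)].
  (* The derivative is frozen at its end values outside the segment; the integral of [g] recovers
     [f] because [f 0 = 0]. *)
  pose (g := fun x => Derive_segm l f (clamp l x)).
  assert (HgL : forall x y, Rabs (g x - g y) <= L * Rabs (x - y)).
  { intros x y. unfold g. eapply Rle_trans; [apply HL; now apply clamp_segm|].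
    apply Rmult_le_compat_l; [lra | now apply clamp_lipschitz]. }
  assert (Hg : forall x, segm l x -> Derive_segm l f x = g x).
  { intros x Hx. unfold g. now rewrite clamp_id. }
  assert (Hf : forall x, segm l x -> f x = RInt g 0 x).
  { intros x Hx. rewrite <- (FTC_segm l f g x); try easy; [lra | |].
    - intros u. now apply (lipschitz_continuous L).
    - intros u Hu. rewrite <- Hg by easy. apply Derive_segm_correct; auto. }
  exists g. repeat split; auto.
  - intros x. unfold g. rewrite (clamp_id l (clamp l x)); [easy | now apply clamp_segm].
  - rewrite <- Hg by (unfold segm; lra). easy.
  - rewrite <- Hf by (unfold segm; lra). easy.
Qed.

Lemma Y_of_YD (L l yl : R) (g : R -> R) :
  0 < l -> YD L l yl g ->
  Y L l yl (RInt g 0) /\ forall x, segm l x -> Derive_segm l (RInt g 0) x = g x.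
Proof.
  intros hl (HL & _ & H0 & Hl).
  assert (Hc : forall x, continuous g x) by (intros x; now apply (lipschitz_continuous L)).
  assert (HD : forall x, D_in (RInt g 0) (fun _ => g x) (segm l) x).
  { intros x. now apply D_in_of_is_derive, is_derive_RInt_continuous. }
  assert (Hg : forall x, segm l x -> Derive_segm l (RInt g 0) x = g x).
  { intros x Hx. now apply Derive_segm_unique. }
  split; [|exact Hg]. repeat split.
  - intros x Hx. exists (g x). apply HD.
  - intros x Hx. rewrite Hg by easy.
    apply filterlim_within_ext with g.
    + intros u Hu. now rewrite Hg.
    + eapply filterlim_filter_le_1; [apply filter_le_within | apply Hc].
  - intros x1 x2 H1 H2. rewrite !Hg by easy. apply HL.
  - exact (RInt_point 0 g).
  - easy.
  - rewrite Hg; [easy | unfold segm; lra].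
Qed.

(** * Dominating sets and their successive halving *)

(** This forces [J] to have the same infimum on [S] as on [P], finite or not. *)
Definition dominating {T : Type} (P : T -> Prop) (J : T -> R) (S : T -> Prop) : Prop :=
  (forall g, S g -> P g) /\ forall f, P f -> exists g, S g /\ J g <= J f.

(** Otherwise some [f1] is strictly better than all of [S] in [A], and some [f2] than all of [S] in
    [B]. An element of [S] at least as good as [f1] then lies in [B], so [J f2 < J f1];
    symmetrically [J f1 < J f2]. *)
Lemma dominating_split {T : Type} (P : T -> Prop) (J : T -> R) (S A B : T -> Prop) :
  dominating P J S -> (forall g, S g -> A g \/ B g) ->
  dominating P J (fun g => S g /\ A g) \/ dominating P J (fun g => S g /\ B g).
Proof.
  intros [HS Hd] HAB. apply NNPP. intros [HnA HnB]%not_or_and.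
  assert (Hbad : forall C : T -> Prop, ~ dominating P J (fun g => S g /\ C g) ->
            exists f, P f /\ forall g, S g -> C g -> J f < J g).
  { intros C HC. apply NNPP. intros Hne. apply HC. split; [intros g Hg; now apply HS|].
    intros f Hf. apply NNPP. intros Hno. apply Hne. exists f. split; [easy|].
    intros g Hg HCg. apply Rnot_le_lt. intros Hle. apply Hno. now exists g. }
  destruct (Hbad A HnA) as (f1 & Hf1 & H1). destruct (Hbad B HnB) as (f2 & Hf2 & H2).
  destruct (Hd f1 Hf1) as (g1 & Hg1 & Hl1). destruct (Hd f2 Hf2) as (g2 & Hg2 & Hl2).
  destruct (HAB g1 Hg1) as [Ha1|Hb1]; [specialize (H1 g1 Hg1 Ha1); lra|].
  destruct (HAB g2 Hg2) as [Ha2|Hb2]; [|specialize (H2 g2 Hg2 Hb2); lra].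
  specialize (H1 g2 Hg2 Ha2). specialize (H2 g1 Hg1 Hb1). lra.
Qed.

Lemma dominating_bisect {T : Type} (P : T -> Prop) (J : T -> R) (v : T -> R) (n : nat) :
  forall (S : T -> Prop) (a b : R), dominating P J S -> (forall g, S g -> a <= v g <= b) ->
  exists S' c, dominating P J S' /\ (forall g, S' g -> S g) /\
    forall g, S' g -> c <= v g <= c + (b - a) / 2 ^ n.
Proof.
  induction n as [|n IH]; intros S a b HS Hv.
  - exists S, a. repeat split; auto; try apply HS; try now apply Hv.
    simpl. specialize (Hv g H). lra.
  - pose (m := (a + b) / 2).
    (* The induction hypothesis applied to a half interval, stated once for both halves. *)
    assert (Hm : forall S' a' b', dominating P J S' -> (forall g, S' g -> S g) ->
              (forall g, S' g -> a' <= v g <= b') -> b' - a' = (b - a) / 2 ->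
        exists S'' c, dominating P J S'' /\ (forall g, S'' g -> S g) /\
        forall g, S'' g -> c <= v g <= c + (b - a) / 2 ^ Datatypes.S n).
    { intros S' a' b' HS' Hsub Hv' Hab.
      destruct (IH S' a' b' HS' Hv') as (S'' & c & H1 & H2 & H3).
      exists S'', c. split; [easy|]. split; [auto|]. intros g Hg.
      replace ((b - a) / 2 ^ Datatypes.S n) with ((b' - a') / 2 ^ n); [auto|].
      rewrite Hab. simpl. field. apply pow_nonzero. lra. }
    destruct (dominating_split P J S (fun g => v g <= m) (fun g => m <= v g) HS) as [H|H].
    + intros g _. lra.
    + apply (Hm _ a m H); [tauto | | unfold m; lra]. intros g [Hg ?]. specialize (Hv g Hg). lra.
    + apply (Hm _ m b H); [tauto | | unfold m; lra]. intros g [Hg ?]. specialize (Hv g Hg). lra.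
Qed.

Lemma dominating_small {T : Type} (P : T -> Prop) (J : T -> R) (v : T -> R)
  (S : T -> Prop) (B eps : R) :
  0 < eps -> dominating P J S -> (forall g, S g -> Rabs (v g) <= B) ->
  exists S', dominating P J S' /\ (forall g, S' g -> S g) /\
    forall g h, S' g -> S' h -> Rabs (v g - v h) <= eps.
Proof.
  intros He HS HB.
  assert (HB' : forall g, S g -> - Rabs B <= v g <= Rabs B).
  { intros g Hg. apply Rabs_le_between. eapply Rle_trans; [now apply HB|]. apply Rle_abs. }
  pose proof (Rabs_pos B).
  (* With [2 ^ n >= 2 * Rabs B / eps], the range of width [2 * Rabs B] has width at most [eps] after
     [n] halvings. *)
  destruct (Pow_x_infinity 2 ltac:(rewrite Rabs_right; lra) (2 * Rabs B / eps)) as [n Hn].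
  specialize (Hn n (le_n n)).
  assert (H2 : 0 < 2 ^ n) by (apply pow_lt; lra).
  rewrite Rabs_right in Hn by lra.
  destruct (dominating_bisect P J v n S _ _ HS HB') as (S' & c & H1 & Hsub & Hc).
  exists S'. split; [easy|]. split; [easy|]. intros g h Hg Hh.
  assert (Hw : (Rabs B - - Rabs B) / 2 ^ n <= eps).
  { apply (Rmult_ge_compat_r eps) in Hn; [|lra]. field_simplify in Hn; [|lra].
    apply Rle_div_l; [easy|]. lra. }
  pose proof (Hc g Hg). pose proof (Hc h Hh). apply Rabs_le. lra.
Qed.

(** The functionals are treated one at a time; passing to a subset keeps the bounds already
    obtained. *)
Lemma dominating_small_grid {T : Type} (P : T -> Prop) (J : T -> R) (v : nat -> T -> R)
  (B eps : R) (N : nat) :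
  0 < eps -> (forall i g, P g -> Rabs (v i g) <= B) ->
  forall S, dominating P J S ->
  exists S', dominating P J S' /\ (forall g, S' g -> S g) /\
    forall i g h, (i < N)%nat -> S' g -> S' h -> Rabs (v i g - v i h) <= eps.
Proof.
  intros He HB S HS. induction N as [|N (S1 & H1 & Hs1 & Hv1)].
  - exists S. repeat split; try apply HS; auto. intros; lia.
  - destruct (dominating_small P J (v N) S1 B eps He H1) as (S2 & H2 & Hs2 & Hv2).
    { intros g Hg. apply HB, H1, Hg. }
    exists S2. split; [easy|]. split; [auto|]. intros i g h Hi Hg Hh.
    destruct (Nat.eq_dec i N) as [->|Hne]; [auto|]. apply Hv1; auto. lia.
Qed.

Lemma dominating_nested {T : Type} (P : T -> Prop) (J : T -> R) (close : nat -> T -> T -> Prop) :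
  (forall n S, dominating P J S -> exists S', dominating P J S' /\ (forall g, S' g -> S g) /\
     forall g h, S' g -> S' h -> close n g h) ->
  exists S : nat -> T -> Prop, (forall n, dominating P J (S n)) /\
    (forall n m g, (n <= m)%nat -> S m g -> S n g) /\
    forall n g h, S n g -> S n h -> close n g h.
Proof.
  intros Hstep.
  (* Each set is bundled with its domination proof, so that choosing a successor becomes a function
     that can be iterated. *)
  pose (D := {S : T -> Prop | dominating P J S}).
  assert (Hnext : forall n (S : D), {S' : D | (forall g, proj1_sig S' g -> proj1_sig S g) /\
     forall g h, proj1_sig S' g -> proj1_sig S' h -> close n g h}).
  { intros n [S HS]. apply constructive_indefinite_description.
    destruct (Hstep n S HS) as (S' & HS' & H). now exists (exist _ S' HS'). }
  assert (H0 : dominating P J P).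
  { split; [easy|]. intros f Hf. exists f. split; [easy|lra]. }
  pose (U := fix U n : D := match n with
     | 0%nat => exist _ P H0 | S m => proj1_sig (Hnext m (U m)) end).
  (* The stage [U 0], which is all of [P], is dropped: [close n] first holds at stage [n + 1]. *)
  exists (fun n => proj1_sig (U (S n))). split; [|split].
  - intros n. apply (proj2_sig (U (S n))).
  - intros n m g Hnm. induction Hnm as [|m _ IH]; [easy|]. intros Hg. apply IH.
    apply (proj2_sig (Hnext (S m) (U (S m)))), Hg.
  - intros n. apply (proj2_sig (Hnext n (U n))).
Qed.

(** * Compactness properties of the set of derivatives *)

Lemma YD_bounded (L l yl : R) (g : R -> R) (x : R) :
  0 < l -> 0 < L -> YD L l yl g -> Rabs (g x) <= L + L * l.
Proof.
  intros hl hL (HL & Hc & H0 & _). rewrite Hc.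
  pose proof (clamp_segm l x hl) as Hx. unfold segm in Hx. set (t := clamp l x) in *.
  replace (g t) with (g 0 + (g t - g 0)) by ring.
  eapply Rle_trans; [apply Rabs_triang|]. apply Rplus_le_compat; [easy|].
  eapply Rle_trans; [apply HL|]. apply Rmult_le_compat_l; [lra|].
  rewrite Rabs_right; lra.
Qed.

Lemma YD_dominating_small (L l yl eps : R) (J : (R -> R) -> R) (S : (R -> R) -> Prop) :
  0 < l -> 0 < L -> 0 < eps -> dominating (YD L l yl) J S ->
  exists S', dominating (YD L l yl) J S' /\ (forall g, S' g -> S g) /\
    forall g h, S' g -> S' h -> forall x, Rabs (g x - h x) <= eps.
Proof.
  intros hl hL He HS.
  (* On this mesh a derivative moves by at most [eps / 4] between a point and the grid point to its
     left. Doing so for [g] and [h], plus [eps / 2] on the grid, makes [eps]. *)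
  pose (d := eps / (4 * L)).
  assert (Hd : 0 < d) by (apply Rdiv_lt_0_compat; lra).
  assert (Hld : 0 <= l / d) by (apply Rlt_le, Rdiv_lt_0_compat; lra).
  (* The grid points in [[0, l]] have indices 0 to [N], hence [N + 1] functionals. *)
  destruct (nfloor_ex (l / d) Hld) as [N HN].
  destruct (dominating_small_grid (YD L l yl) J (fun i g => g (INR i * d))
    (L + L * l) (eps / 2) (Datatypes.S N)) with (S := S) as (S' & HS' & Hsub & Hv); auto.
  { lra. }
  { intros i g Hg. now apply (YD_bounded L l yl). }
  exists S'. split; [easy|]. split; [easy|]. intros g h Hg Hh x.
  destruct (proj1 HS' g Hg) as (HLg & Hcg & _). destruct (proj1 HS' h Hh) as (HLh & Hch & _).
  rewrite Hcg, Hch. pose proof (clamp_segm l x hl) as Hx. unfold segm in Hx.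
  set (t := clamp l x) in *.
  assert (Htd : 0 <= t / d) by (apply Rdiv_le_0_compat; lra).
  destruct (nfloor_ex (t / d) Htd) as [i Hi].
  assert (HiN : (i < Datatypes.S N)%nat).
  { apply INR_lt. rewrite S_INR. apply Rle_lt_trans with (t / d); [lra|].
    apply Rle_lt_trans with (l / d); [|lra]. apply Rmult_le_compat_r; [|lra].
    now apply Rlt_le, Rinv_0_lt_compat. }
  specialize (Hv i g h HiN Hg Hh).
  assert (Hclose : Rabs (t - INR i * d) <= d).
  { replace (t - INR i * d) with ((t / d - INR i) * d) by (field; lra).
    rewrite Rabs_right by (apply Rle_ge, Rmult_le_pos; lra).
    apply Rle_trans with (1 * d); [apply Rmult_le_compat_r|]; lra. }
  assert (HLd : L * Rabs (t - INR i * d) <= eps / 4).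
  { apply Rle_trans with (L * d); [apply Rmult_le_compat_l; lra|].
    right. unfold d. field. lra. }
  specialize (HLg t (INR i * d)). specialize (HLh t (INR i * d)).
  apply Rabs_le. apply Rabs_le_between in Hv.
  assert (Hg4 := Rle_trans _ _ _ HLg HLd). assert (Hh4 := Rle_trans _ _ _ HLh HLd).
  apply Rabs_le_between in Hg4, Hh4. lra.
Qed.

(** The pointwise conditions pass to the limit directly; the prescribed integral does so because the
    common Lipschitz constant gives continuous convergence. *)
Lemma YD_closed (L l yl : R) (G : nat -> R -> R) (g : R -> R) :
  (forall k, YD L l yl (G k)) -> (forall x, is_lim_seq (fun k => G k x) (g x)) ->
  YD L l yl g.
Proof.
  intros HG Hl.
  assert (Habs : forall x y, is_lim_seq (fun k => Rabs (G k x - G k y)) (Rabs (g x - g y))).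
  { intros x y. apply (is_lim_seq_abs _ (g x - g y)). now apply is_lim_seq_minus'. }
  repeat split.
  - intros x y. apply (is_lim_seq_le _ _ (Rabs (g x - g y)) (L * Rabs (x - y)))
      with (2 := Habs x y) (3 := is_lim_seq_const _).
    intros k. apply HG.
  - intros x. assert (H := is_lim_seq_unique _ _ (Hl x)).
    rewrite (Lim_seq_ext _ (fun k => G k (clamp l x))) in H by (intros k; apply HG).
    rewrite (is_lim_seq_unique _ _ (Hl (clamp l x))) in H. congruence.
  - apply (is_lim_seq_le (fun k => Rabs (G k 0)) (fun _ => L) (Rabs (g 0)) L).
    + intros k. apply HG.
    + now apply (is_lim_seq_abs _ (g 0)).
    + apply is_lim_seq_const.
  - assert (HC : cconv G g) by (apply (cconv_of_lipschitz L); [intros k; apply HG | easy]).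
    assert (H := is_lim_seq_unique _ _ (cconv_pointwise _ _ l (cconv_RInt _ _ HC))).
    rewrite (Lim_seq_ext _ (fun _ => yl)), Lim_seq_const in H by (intros k; apply HG).
    congruence.
Qed.

(** * Existence of a minimizer *)

Lemma JD_attains_min (L l yl : R) (alpha beta phi : R -> R -> R) :
  0 < l -> 0 < L -> Cn_plane 1 alpha -> Cn_plane 1 beta -> Cn_plane 2 phi ->
  (exists f, YD L l yl f) ->
  exists g, YD L l yl g /\
    forall f, YD L l yl f -> JD alpha beta phi l g <= JD alpha beta phi l f.
Proof.
  intros hl hL Ha Hb Hp [f0 Hf0].
  destruct (dominating_nested (YD L l yl) (JD alpha beta phi l)
    (fun n g h => forall x, Rabs (g x - h x) <= / (INR n + 1))) as (S & HS & Hnest & Hclose).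
  { intros n S HS. apply YD_dominating_small; auto. apply RinvN_pos. }
  assert (Hpick : forall f, YD L l yl f -> exists G : nat -> R -> R, forall k,
            S k (G k) /\ JD alpha beta phi l (G k) <= JD alpha beta phi l f).
  { intros f Hf.
    pose (P := fun k => constructive_indefinite_description _ (proj2 (HS k) f Hf)).
    exists (fun k => proj1_sig (P k)). intros k. apply (proj2_sig (P k)). }
  assert (Hsmall : forall eps : posreal, exists N, forall k, (N <= k)%nat -> / (INR k + 1) < eps).
  { intros eps. destruct (RinvN_cv (cond_pos eps)) as [N HN]. exists N. intros k Hk.
    specialize (HN k Hk). unfold Rdist in HN. rewrite Rminus_0_r in HN.
    eapply Rle_lt_trans; [apply Rle_abs | exact HN]. }
  (* One selection from the shrinking sets is Cauchy at each point and defines the candidate [g]. *)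
  destruct (Hpick f0 Hf0) as [G0 HG0].
  assert (Hlim0 : forall x, ex_finite_lim_seq (fun k => G0 k x)).
  { intros x. apply ex_lim_seq_cauchy_corr. intros eps.
    destruct (Hsmall eps) as [N HN]. exists N. intros n m Hn Hm.
    eapply Rle_lt_trans; [|apply (HN N); lia].
    apply Hclose; [apply (Hnest N n) | apply (Hnest N m)]; auto; apply HG0. }
  pose (g := fun x => real (Lim_seq (fun k => G0 k x))).
  (* Any other selection has the same limit, since [G k] and [G0 k] both lie in [S k]. *)
  assert (Hlim : forall G : nat -> R -> R, (forall k, S k (G k)) ->
            forall x, is_lim_seq (fun k => G k x) (g x)).
  { intros G HG x.
    apply is_lim_seq_ext with (fun k => G0 k x + (G k x - G0 k x)); [intros; ring|].
    replace (g x) with (g x + 0) by ring.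
    apply is_lim_seq_plus'; [now apply Lim_seq_correct', Hlim0|].
    apply is_lim_seq_spec. intros eps. destruct (Hsmall eps) as [N HN]. exists N. intros k Hk.
    rewrite Rminus_0_r. eapply Rle_lt_trans; [|apply (HN k Hk)].
    apply Hclose; [apply HG | apply HG0]. }
  exists g. split.
  - apply (YD_closed L l yl G0); [intros k; apply (proj1 (HS k)), HG0|].
    apply Hlim, HG0.
  (* For each competitor [f], a selection of elements no worse than [f] also tends to [g], and [JD]
     passes to the limit. *)
  - intros f Hf. destruct (Hpick f Hf) as [G HG].
    assert (HC : cconv G g).
    { apply (cconv_of_lipschitz L); [|apply Hlim, HG].
      intros k. apply (proj1 (HS k) (G k)), HG. }
    apply (is_lim_seq_le _ _ (JD alpha beta phi l g) (JD alpha beta phi l f))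
      with (2 := JD_lim alpha beta phi l G g Ha Hb Hp HC) (3 := is_lim_seq_const _).
    intros k. apply HG.
Qed.

Theorem mainTheorem1 (l L yl : R) (alpha beta phi : R -> R -> R)
  (hl : 0 < l) (hL : 0 < L)
  (halpha : Cn_plane 1 alpha) (hbeta : Cn_plane 1 beta)
  (hphi : Cn_plane 2 phi) (hphi0 : phi 0 0 = 0)
  (hY : exists f : R -> R, Y L l yl f) :
  exists y : R -> R, Y L l yl y /\
    forall f : R -> R, Y L l yl f -> J alpha beta phi l y <= J alpha beta phi l f.
Proof.
  destruct (JD_attains_min L l yl alpha beta phi) as (g & Hg & Hmin); auto.
  { destruct hY as [f Hf]. destruct (YD_of_Y L l yl f hl hL Hf) as (h & Hh & _). now exists h. }
  destruct (Y_of_YD L l yl g hl Hg) as [HY HD].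
  (* The minimizer is the primitive of the optimal derivative; a competitor [f] is compared with it
     through its own derivative [h]. *)
  exists (RInt g 0). split; [exact HY|]. intros f Hf.
  destruct (YD_of_Y L l yl f hl hL Hf) as (h & Hh & Hfh & HDh).
  rewrite (J_eq_JD alpha beta phi l f h hl Hfh HDh).
  rewrite (J_eq_JD alpha beta phi l (RInt g 0) g hl); auto.
Qed.
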